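(* Let $\mathscr{C}$ be an additive category and let $\{( *_i,\omega_i)\}_{i\in I}$ be a nonempty family of hermitian structures on $\mathscr{C}$. Define a functor $F:\mathrm{Sesq}_I(\mathscr{C})\to \mathrm{UH}^1(\widetilde{\mathrm{Ar}}_{2I}(\mathscr{C}))$ by $$F(M,\{s_i\}_{i\in I})=\big((M,M,\{s_i^{*_i}\omega_{i,M}\}_{i\in I},\{s_i\}_{i\in I}),(\mathrm{id}_M,\mathrm{id}_M^{\mathrm{op}})\big),\qquad F(\psi)=(\psi,(\psi^{-1})^{\mathrm{op}})$$ for every system of sesquilinear forms $(M,\{s_i\})$ and every isometry $\psi$. Then $F$ is an equivalence of categories between $\mathrm{Sesq}_I(\mathscr{C})$ and $\mathrm{UH}^1(\widetilde{\mathrm{Ar}}_{2I}(\mathscr{C}))$.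
   Context: A hermitian structure on an additive category $\mathscr{C}$ is a pair $( *,\omega)$ with $*:\mathscr{C}\to\mathscr{C}$ an (additive) contravariant functor and $\omega:\mathrm{id}\to **$ a natural transformation (not necessarily an isomorphism) satisfying $\omega_C^*\,\omega_{C^*}=\mathrm{id}_{C^*}$ for all $C$. The triple $(\mathscr{C},*,\omega)$ is then a hermitian category. A sesquilinear form over a hermitian category is a pair $(C,s)$ with $s:C\to C^*$ a morphism. It is unimodular if $s$ and $s^*\omega_C$ are isomorphisms, and $1$-hermitian if $s=s^*\omega_C$. An isometry $(C,s)\to(C',s')$ is an isomorphism $f:C\to C'$ with $s=f^*s'f$. $\mathrm{UH}^1(\mathscr{D})$ denotes the category of unimodular $1$-hermitian forms over a hermitian category $\mathscr{D}$, with isometries as morphisms. A system of sesquilinear forms over $(\mathscr{C},\{*_i,\omega_i\}_{i\in I})$ is a pair $(M,\{s_i\}_{i\in I})$ with $M\in\mathscr{C}$ and $s_i:M\to M^{*_i}$ a morphism for each $i$. An isometry $(M,\{s_i\})\to(M',\{s_i'\})$ is an isomorphism $f:M\to M'$ with $f^{*_i}s_i'f=s_i$ for all $i$. $\mathrm{Sesq}_I(\mathscr{C})$ is the category of such systems with isometries as morphisms. The category $\widetilde{\mathrm{Ar}}_{2I}(\mathscr{C})$ of twisted double $I$-arrows has as objects the quadruples $(M,N,\{f_i\}_{i\in I},\{g_i\}_{i\in I})$ with $M,N\in\mathscr{C}$ and $f_i,g_i\in\mathrm{Hom}_{\mathscr{C}}(M,N^{*_i})$. A morphism $(M,N,\{f_i\},\{g_i\})\to(M',N',\{f'_i\},\{g'_i\})$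 is a formal pair $(\phi,\psi^{\mathrm{op}})$ with $\phi\in\mathrm{Hom}(M,M')$, $\psi\in\mathrm{Hom}(N',N)$, $\psi^{*_i}f_i=f_i'\phi$ and $\psi^{*_i}g_i=g'_i\phi$ for all $i$. Composition is $(\phi,\psi^{\mathrm{op}})(\phi',\psi'^{\mathrm{op}})=(\phi\phi',(\psi'\psi)^{\mathrm{op}})$. It is a hermitian category via $(M,N,\{f_i\},\{g_i\})^*=(N,M,\{g_i^{*_i}\omega_{i,N}\},\{f_i^{*_i}\omega_{i,N}\})$, $(\phi,\psi^{\mathrm{op}})^*=(\psi,\phi^{\mathrm{op}})$ and $\omega_{(M,N,\{f_i\},\{g_i\})}=(\mathrm{id}_M,\mathrm{id}_N^{\mathrm{op}})$. *)

(* Defs.v *)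
From HB Require Import structures.
From mathcomp Require Import all_boot ssralg.
From mathcomp Require Import boolp.

Set Implicit Arguments.
Unset Strict Implicit.
Unset Printing Implicit Defensive.

Import GRing.Theory.
Local Open Scope ring_scope.

Record Category := MkCategory {
  ob :> Type;
  Hom : ob -> ob -> Type;
  idm : forall A, Hom A A;
  comp : forall A B D, Hom B D -> Hom A B -> Hom A D;
  comp_assoc : forall A B D E (h : Hom D E) (g : Hom B D) (f : Hom A B),
    comp h (comp g f) = comp (comp h g) f;
  comp_idl : forall A B (f : Hom A B), comp (idm B) f = f;
  comp_idr : forall A B (f : Hom A B), comp f (idm A) = f
}.

Arguments Hom {c} A B.
Arguments idm {c} A.
Arguments comp {c A B D} g f.

Declare Scope cat_scope.
Delimit Scope cat_scope with cat.
Notation "g ∘ f" := (comp g f) (at level 40, left associativity) : cat_scope.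
Local Open Scope cat_scope.

(* The inverse is carried as data; by uniqueness of inverses this is no extra
   structure, see [iso_eq]. *)
Record Iso (C : Category) (A B : C) := MkIso {
  iso_hom :> Hom A B;
  iso_inv : Hom B A;
  iso_invl : iso_inv ∘ iso_hom = idm A;
  iso_invr : iso_hom ∘ iso_inv = idm B
}.

Definition is_iso (C : Category) (A B : C) (f : Hom A B) : Prop :=
  exists u : Iso A B, iso_hom u = f.

Lemma iso_eq (C : Category) (A B : C) (u v : Iso A B) :
  iso_hom u = iso_hom v -> u = v.
Proof.
case: u v => [f g gf fg] [f' g' gf' fg'] /= E; subst f'.
have E : g = g' by rewrite -(comp_idr g) -fg' comp_assoc gf comp_idl.
by subst g'; congr MkIso; apply: Prop_irrelevance.
Qed.

Definition iso_id (C : Category) (A : C) : Iso A A :=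
  MkIso (comp_idl (idm A)) (comp_idl (idm A)).

Lemma iso_comp_proofs (C : Category) (A B D : C) (v : Iso B D) (u : Iso A B) :
  (iso_inv u ∘ iso_inv v) ∘ (v ∘ u) = idm A /\
  (v ∘ u) ∘ (iso_inv u ∘ iso_inv v) = idm D.
Proof.
split.
- by rewrite comp_assoc -(comp_assoc (iso_inv u)) iso_invl comp_idr iso_invl.
- by rewrite comp_assoc -(comp_assoc (iso_hom v)) iso_invr comp_idr iso_invr.
Qed.

Definition iso_comp (C : Category) (A B D : C) (v : Iso B D) (u : Iso A B) :
    Iso A D :=
  MkIso (proj1 (iso_comp_proofs v u)) (proj2 (iso_comp_proofs v u)).

Record Functor (C D : Category) := MkFunctor {
  fob :> C -> D;
  fmap : forall A B : C, Hom A B -> Hom (fob A) (fob B);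
  fmap_id : forall A : C, fmap (idm A) = idm (fob A);
  fmap_comp : forall (A B E : C) (g : Hom B E) (f : Hom A B),
    fmap (g ∘ f) = fmap g ∘ fmap f
}.

Arguments fmap {C D} F {A B} f : rename.

Definition functor_id (C : Category) : Functor C C :=
  MkFunctor (fob := fun A => A) (fmap := fun A B f => f)
    (fun _ => erefl) (fun _ _ _ _ _ => erefl).

Lemma functor_comp_id (C D E : Category) (G : Functor D E) (F : Functor C D)
  (A : C) : fmap G (fmap F (idm A)) = idm (G (F A)).
Proof. by rewrite !fmap_id. Qed.

Lemma functor_comp_comp (C D E : Category) (G : Functor D E) (F : Functor C D)
  (A B B' : C) (g : Hom B B') (f : Hom A B) :
  fmap G (fmap F (g ∘ f)) = fmap G (fmap F g) ∘ fmap G (fmap F f).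
Proof. by rewrite !fmap_comp. Qed.

Definition functor_comp (C D E : Category) (G : Functor D E) (F : Functor C D) :
    Functor C E :=
  MkFunctor (fob := fun A => G (F A)) (fmap := fun A B f => fmap G (fmap F f))
    (@functor_comp_id C D E G F) (@functor_comp_comp C D E G F).

Record NatIso (C D : Category) (F G : Functor C D) := MkNatIso {
  nat_iso :> forall A : C, Iso (F A) (G A);
  nat_isoP : forall (A B : C) (f : Hom A B),
    nat_iso B ∘ fmap F f = fmap G f ∘ nat_iso A
}.

Definition is_equivalence (C D : Category) (F : Functor C D) : Prop :=
  exists G : Functor D C,
    inhabited (NatIso (functor_comp G F) (functor_id C)) /\
    inhabited (NatIso (functor_comp F G) (functor_id D)).

(* The abelian group structures on the Hom sets come as instances of
   MathComp's [zmodType]; the choice operator this includes is no restriction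
   in the presence of the axioms of [boolp]. *)
Record PreadditiveCategory := MkPreadditiveCategory {
  pcat :> Category;
  hom_zmod : forall A B : pcat, GRing.Zmodule (Hom A B)
}.

HB.instance Definition _ (C : PreadditiveCategory) (A B : C) :
  GRing.Zmodule (Hom A B) := hom_zmod A B.

Definition is_zero_object (C : Category) (Z : C) : Prop :=
  forall A : C, (exists! f : Hom A Z, True) /\ (exists! f : Hom Z A, True).

Definition is_biproduct (C : PreadditiveCategory) (A B P : C)
    (i1 : Hom A P) (i2 : Hom B P) (p1 : Hom P A) (p2 : Hom P B) : Prop :=
  [/\ p1 ∘ i1 = idm A, p2 ∘ i2 = idm B, p1 ∘ i2 = 0, p2 ∘ i1 = 0
    & i1 ∘ p1 + i2 ∘ p2 = idm P].

Record AdditiveCategory := MkAdditiveCategory {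
  acat :> PreadditiveCategory;
  comp_addl : forall (A B D : acat) (g g' : Hom B D) (f : Hom A B),
    (g + g') ∘ f = g ∘ f + g' ∘ f;
  comp_addr : forall (A B D : acat) (g : Hom B D) (f f' : Hom A B),
    g ∘ (f + f') = g ∘ f + g ∘ f';
  has_zero_object : exists Z : acat, is_zero_object Z;
  has_biproducts : forall A B : acat,
    exists (P : acat) (i1 : Hom A P) (i2 : Hom B P)
           (p1 : Hom P A) (p2 : Hom P B), is_biproduct i1 i2 p1 p2
}.

Lemma comp_0l (C : AdditiveCategory) (A B D : C) (f : Hom A B) :
  (0 : Hom B D) ∘ f = 0.
Proof. by apply: (addrI ((0 : Hom B D) ∘ f)); rewrite -comp_addl !addr0. Qed.

Lemma comp_0r (C : AdditiveCategory) (A B D : C) (g : Hom B D) :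
  g ∘ (0 : Hom A B) = 0.
Proof. by apply: (addrI (g ∘ (0 : Hom A B))); rewrite -comp_addr !addr0. Qed.

Lemma comp_oppl (C : AdditiveCategory) (A B D : C) (g : Hom B D) (f : Hom A B) :
  (- g) ∘ f = - (g ∘ f).
Proof. by apply: (addrI (g ∘ f)); rewrite -comp_addl !subrr comp_0l. Qed.

Lemma comp_oppr (C : AdditiveCategory) (A B D : C) (g : Hom B D) (f : Hom A B) :
  g ∘ (- f) = - (g ∘ f).
Proof. by apply: (addrI (g ∘ f)); rewrite -comp_addr !subrr comp_0r. Qed.

Record HermitianStructure (C : AdditiveCategory) := MkHermitianStructure {
  dual : C -> C;
  dualm : forall A B : C, Hom A B -> Hom (dual B) (dual A);
  dualm_id : forall A : C, dualm (idm A) = idm (dual A);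
  dualm_comp : forall (A B D : C) (g : Hom B D) (f : Hom A B),
    dualm (g ∘ f) = dualm f ∘ dualm g;
  dualm_add : forall (A B : C) (f g : Hom A B),
    dualm (f + g) = dualm f + dualm g;
  omega : forall A : C, Hom A (dual (dual A));
  omega_nat : forall (A B : C) (f : Hom A B),
    omega B ∘ f = dualm (dualm f) ∘ omega A;
  omega_dual : forall A : C, dualm (omega A) ∘ omega (dual A) = idm (dual A)
}.

Arguments dual {C} h A.
Arguments dualm {C} h {A B} f.
Arguments omega {C} h A.

Record HermitianCategory := MkHermitianCategory {
  hcat :> AdditiveCategory;
  hstr : HermitianStructure hcat
}.

(* With [N = M] this is the [s^* ω_M] of unimodular and hermitian forms; for
   general [M], [N] it gives the dual of a twisted double arrow. *)
Definition adj (C : AdditiveCategory) (h : HermitianStructure C) (M N : C)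
    (f : Hom M (dual h N)) : Hom N (dual h M) :=
  dualm h f ∘ omega h N.

Section HermitianLemmas.
Variables (C : AdditiveCategory) (h : HermitianStructure C).

Lemma adjK (M N : C) (f : Hom M (dual h N)) : adj (adj f) = f.
Proof.
by rewrite /adj dualm_comp -comp_assoc -omega_nat comp_assoc omega_dual comp_idl.
Qed.

Lemma dualm_0 (A B : C) : dualm h (0 : Hom A B) = 0.
Proof. by apply: (addrI (dualm h (0 : Hom A B))); rewrite -dualm_add !addr0. Qed.

Lemma dualm_opp (A B : C) (f : Hom A B) : dualm h (- f) = - dualm h f.
Proof. by apply: (addrI (dualm h f)); rewrite -dualm_add !subrr dualm_0. Qed.

Lemma adj_intertwine (M N M' N' : C) (f : Hom M (dual h N))
    (f' : Hom M' (dual h N')) (phi : Hom M M') (psi : Hom N' N) :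
  dualm h psi ∘ f = f' ∘ phi -> dualm h phi ∘ adj f' = adj f ∘ psi.
Proof.
move=> E; rewrite /adj comp_assoc -dualm_comp -E dualm_comp -!comp_assoc.
by rewrite omega_nat.
Qed.

End HermitianLemmas.

Record SesqForm (D : HermitianCategory) := MkSesqForm {
  form_ob : D;
  form_mor : Hom form_ob (dual (hstr D) form_ob)
}.

Definition unimodular (D : HermitianCategory) (X : SesqForm D) : Prop :=
  is_iso (form_mor X) /\ is_iso (adj (form_mor X)).

Definition hermitian1 (D : HermitianCategory) (X : SesqForm D) : Prop :=
  form_mor X = adj (form_mor X).

Record Isometry (D : HermitianCategory) (X Y : SesqForm D) := MkIsometry {
  isom_iso :> Iso (form_ob X) (form_ob Y);
  isomP : form_mor X = dualm (hstr D) isom_iso ∘ form_mor Y ∘ isom_iso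
}.

Record UH1_ob (D : HermitianCategory) := MkUH1_ob {
  uh_form :> SesqForm D;
  uh_unimodular : unimodular uh_form;
  uh_hermitian : hermitian1 uh_form
}.

Section UH1.
Variable D : HermitianCategory.

Lemma isom_eq (X Y : SesqForm D) (u v : Isometry X Y) :
  iso_hom u = iso_hom v -> u = v.
Proof.
case: u v => [u p] [v q] /= /iso_eq E; subst v.
by congr MkIsometry; apply: Prop_irrelevance.
Qed.

Lemma isom_id_proof (X : SesqForm D) :
  form_mor X =
    dualm (hstr D) (iso_id (form_ob X)) ∘ form_mor X ∘ iso_id (form_ob X).
Proof. by rewrite /= dualm_id comp_idl comp_idr. Qed.

Lemma isom_comp_proof (X Y Z : SesqForm D) (v : Isometry Y Z) (u : Isometry X Y) :
  form_mor X = dualm (hstr D) (iso_comp v u) ∘ form_mor Z ∘ iso_comp v u.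
Proof. by rewrite (isomP u) (isomP v) /= dualm_comp !comp_assoc. Qed.

Definition UH1 : Category.
Proof.
refine {| ob := UH1_ob D;
          Hom := fun X Y => Isometry X Y;
          idm := fun X => MkIsometry (isom_id_proof X);
          comp := fun X Y Z v u => MkIsometry (isom_comp_proof v u) |}.
- by move=> *; apply: isom_eq; rewrite /= comp_assoc.
- by move=> *; apply: isom_eq; rewrite /= comp_idl.
- by move=> *; apply: isom_eq; rewrite /= comp_idr.
Defined.

End UH1.

Section Systems.
Variables (C : AdditiveCategory) (I : Type) (h : I -> HermitianStructure C).

Record SesqSystem := MkSesqSystem {
  sys_ob : C;
  sys_form : forall i, Hom sys_ob (dual (h i) sys_ob)
}.

Record SysIsometry (X Y : SesqSystem) := MkSysIsometry {
  sysisom_iso :> Iso (sys_ob X) (sys_ob Y);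
  sysisomP : forall i,
    dualm (h i) sysisom_iso ∘ sys_form Y i ∘ sysisom_iso = sys_form X i
}.

Lemma sysisom_eq (X Y : SesqSystem) (u v : SysIsometry X Y) :
  iso_hom u = iso_hom v -> u = v.
Proof.
case: u v => [u p] [v q] /= /iso_eq E; subst v.
by congr MkSysIsometry; apply: Prop_irrelevance.
Qed.

Lemma sysisom_id_proof (X : SesqSystem) i :
  dualm (h i) (iso_id (sys_ob X)) ∘ sys_form X i ∘ iso_id (sys_ob X)
  = sys_form X i.
Proof. by rewrite /= dualm_id comp_idl comp_idr. Qed.

Lemma sysisom_comp_proof (X Y Z : SesqSystem)
    (v : SysIsometry Y Z) (u : SysIsometry X Y) i :
  dualm (h i) (iso_comp v u) ∘ sys_form Z i ∘ iso_comp v u = sys_form X i.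
Proof. by rewrite -(sysisomP u) -(sysisomP v) /= dualm_comp !comp_assoc. Qed.

Definition Sesq : Category.
Proof.
refine {| ob := SesqSystem;
          Hom := SysIsometry;
          idm := fun X => MkSysIsometry (sysisom_id_proof X);
          comp := fun X Y Z v u => MkSysIsometry (sysisom_comp_proof v u) |}.
- by move=> *; apply: sysisom_eq; rewrite /= comp_assoc.
- by move=> *; apply: sysisom_eq; rewrite /= comp_idl.
- by move=> *; apply: sysisom_eq; rewrite /= comp_idr.
Defined.

Record TwArrow := MkTwArrow {
  tw_M : C;
  tw_N : C;
  tw_f : forall i, Hom tw_M (dual (h i) tw_N);
  tw_g : forall i, Hom tw_M (dual (h i) tw_N)
}.

(* [MkTwHom phi psi _ _] is the formal pair (phi, psi^op); note the direction
   of [psi]. *)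
Record TwHom (X Y : TwArrow) := MkTwHom {
  tw_phi : Hom (tw_M X) (tw_M Y);
  tw_psi : Hom (tw_N Y) (tw_N X);
  tw_compat_f : forall i, dualm (h i) tw_psi ∘ tw_f X i = tw_f Y i ∘ tw_phi;
  tw_compat_g : forall i, dualm (h i) tw_psi ∘ tw_g X i = tw_g Y i ∘ tw_phi
}.

Lemma twhom_eq (X Y : TwArrow) (u v : TwHom X Y) :
  tw_phi u = tw_phi v -> tw_psi u = tw_psi v -> u = v.
Proof.
case: u v => [a b p q] [a' b' p' q'] /= Ea Eb; subst a' b'.
by congr MkTwHom; apply: Prop_irrelevance.
Qed.

Definition tw_id (X : TwArrow) : TwHom X X.
Proof.
by exists (idm (tw_M X)) (idm (tw_N X)) => i;
  rewrite dualm_id comp_idl comp_idr.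
Defined.

Definition tw_comp (X Y Z : TwArrow) (v : TwHom Y Z) (u : TwHom X Y) :
  TwHom X Z.
Proof.
exists (tw_phi v ∘ tw_phi u) (tw_psi u ∘ tw_psi v) => i.
- by rewrite dualm_comp -comp_assoc tw_compat_f !comp_assoc tw_compat_f.
- by rewrite dualm_comp -comp_assoc tw_compat_g !comp_assoc tw_compat_g.
Defined.

Definition TwAr_cat : Category.
Proof.
refine {| ob := TwArrow; Hom := TwHom; idm := tw_id; comp := tw_comp |}.
- by move=> *; apply: twhom_eq; rewrite /= comp_assoc.
- by move=> *; apply: twhom_eq; rewrite /= ?comp_idl ?comp_idr.
- by move=> *; apply: twhom_eq; rewrite /= ?comp_idl ?comp_idr.
Defined.

Definition tw_zero (X Y : TwArrow) : TwHom X Y.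
Proof. by exists 0 0 => i; rewrite dualm_0 comp_0l comp_0r. Defined.

Definition tw_opp (X Y : TwArrow) (u : TwHom X Y) : TwHom X Y.
Proof.
exists (- tw_phi u) (- tw_psi u) => i.
- by rewrite dualm_opp comp_oppl comp_oppr tw_compat_f.
- by rewrite dualm_opp comp_oppl comp_oppr tw_compat_g.
Defined.

Definition tw_add (X Y : TwArrow) (u v : TwHom X Y) : TwHom X Y.
Proof.
exists (tw_phi u + tw_phi v) (tw_psi u + tw_psi v) => i.
- by rewrite dualm_add comp_addl comp_addr !tw_compat_f.
- by rewrite dualm_add comp_addl comp_addr !tw_compat_g.
Defined.

Lemma tw_addA (X Y : TwArrow) : associative (@tw_add X Y).
Proof. by move=> u v w; apply: twhom_eq; rewrite /= addrA. Qed.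

Lemma tw_addC (X Y : TwArrow) : commutative (@tw_add X Y).
Proof. by move=> u v; apply: twhom_eq; rewrite /= addrC. Qed.

Lemma tw_add0 (X Y : TwArrow) : left_id (tw_zero X Y) (@tw_add X Y).
Proof. by move=> u; apply: twhom_eq; rewrite /= add0r. Qed.

Lemma tw_addN (X Y : TwArrow) :
  left_inverse (tw_zero X Y) (@tw_opp X Y) (@tw_add X Y).
Proof. by move=> u; apply: twhom_eq; rewrite /= addNr. Qed.

HB.instance Definition _ (X Y : TwArrow) := gen_eqMixin (TwHom X Y).
HB.instance Definition _ (X Y : TwArrow) := gen_choiceMixin (TwHom X Y).
HB.instance Definition _ (X Y : TwArrow) :=
  GRing.isZmodule.Build (TwHom X Y)
    (@tw_addA X Y) (@tw_addC X Y) (@tw_add0 X Y) (@tw_addN X Y).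

Definition TwAr_preadd : PreadditiveCategory :=
  @MkPreadditiveCategory TwAr_cat
    (fun X Y => GRing.Zmodule.on (TwHom X Y)).

Lemma tw_comp_addl (X Y Z : TwAr_preadd) (g g' : Hom Y Z) (f : Hom X Y) :
  (g + g') ∘ f = g ∘ f + g' ∘ f.
Proof. by apply: twhom_eq; rewrite /= ?comp_addl ?comp_addr. Qed.

Lemma tw_comp_addr (X Y Z : TwAr_preadd) (g : Hom Y Z) (f f' : Hom X Y) :
  g ∘ (f + f') = g ∘ f + g ∘ f'.
Proof. by apply: twhom_eq; rewrite /= ?comp_addl ?comp_addr. Qed.

Lemma tw_has_zero_object : exists Z : TwAr_preadd, is_zero_object Z.
Proof.
have [Z zZ] := has_zero_object C.
have toZ (A : C) (f g : Hom A Z) : f = g.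
  by have [[z [_ zP]] _] := zZ A; rewrite -(zP f) // -(zP g).
have frZ (A : C) (f g : Hom Z A) : f = g.
  by have [_ [z [_ zP]]] := zZ A; rewrite -(zP f) // -(zP g).
exists (@MkTwArrow Z Z (fun=> 0) (fun=> 0)) => X; split.
- by exists (tw_zero X _); split=> // u _; apply: twhom_eq; [apply: toZ|apply: frZ].
- by exists (tw_zero _ X); split=> // u _; apply: twhom_eq; [apply: frZ|apply: toZ].
Qed.

Section Biproduct.
Variables (M M' P N N' Q : C).
Variables (i1 : Hom M P) (i2 : Hom M' P) (p1 : Hom P M) (p2 : Hom P M').
Variables (j1 : Hom N Q) (j2 : Hom N' Q) (q1 : Hom Q N) (q2 : Hom Q N').
Hypothesis bP : is_biproduct i1 i2 p1 p2.
Hypothesis bQ : is_biproduct j1 j2 q1 q2.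

Definition bisum i (f : Hom M (dual (h i) N)) (f' : Hom M' (dual (h i) N')) :
    Hom P (dual (h i) Q) :=
  dualm (h i) q1 ∘ f ∘ p1 + dualm (h i) q2 ∘ f' ∘ p2.

Lemma bisum_i1 i (f : Hom M (dual (h i) N)) (f' : Hom M' (dual (h i) N')) :
  dualm (h i) q1 ∘ f = bisum f f' ∘ i1.
Proof.
have [a _ _ b _] := bP.
by rewrite /bisum comp_addl -!comp_assoc a b !comp_0r addr0 comp_idr.
Qed.

Lemma bisum_i2 i (f : Hom M (dual (h i) N)) (f' : Hom M' (dual (h i) N')) :
  dualm (h i) q2 ∘ f' = bisum f f' ∘ i2.
Proof.
have [_ a b _ _] := bP.
by rewrite /bisum comp_addl -!comp_assoc a b !comp_0r add0r comp_idr.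
Qed.

Lemma bisum_p1 i (f : Hom M (dual (h i) N)) (f' : Hom M' (dual (h i) N')) :
  dualm (h i) j1 ∘ bisum f f' = f ∘ p1.
Proof.
have [a _ _ b _] := bQ.
rewrite /bisum comp_addr !comp_assoc -!dualm_comp a b dualm_0 dualm_id.
by rewrite !comp_0l addr0 comp_idl.
Qed.

Lemma bisum_p2 i (f : Hom M (dual (h i) N)) (f' : Hom M' (dual (h i) N')) :
  dualm (h i) j2 ∘ bisum f f' = f' ∘ p2.
Proof.
have [_ a b _ _] := bQ.
rewrite /bisum comp_addr !comp_assoc -!dualm_comp a b dualm_0 dualm_id.
by rewrite !comp_0l add0r comp_idl.
Qed.

End Biproduct.

Lemma tw_has_biproducts (X Y : TwAr_preadd) :
  exists (Z : TwAr_preadd) (i1 : Hom X Z) (i2 : Hom Y Z)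
         (p1 : Hom Z X) (p2 : Hom Z Y), is_biproduct i1 i2 p1 p2.
Proof.
have [P [i1 [i2 [p1 [p2 bP]]]]] := has_biproducts (tw_M X) (tw_M Y).
have [Q [j1 [j2 [q1 [q2 bQ]]]]] := has_biproducts (tw_N X) (tw_N Y).
pose Z := MkTwArrow (fun i => bisum p1 p2 q1 q2 (tw_f X i) (tw_f Y i))
                    (fun i => bisum p1 p2 q1 q2 (tw_g X i) (tw_g Y i)).
exists Z.
exists (@MkTwHom X Z i1 q1 (fun i => bisum_i1 q1 q2 bP (tw_f X i) (tw_f Y i))
                           (fun i => bisum_i1 q1 q2 bP (tw_g X i) (tw_g Y i))).
exists (@MkTwHom Y Z i2 q2 (fun i => bisum_i2 q1 q2 bP (tw_f X i) (tw_f Y i))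
                           (fun i => bisum_i2 q1 q2 bP (tw_g X i) (tw_g Y i))).
exists (@MkTwHom Z X p1 j1 (fun i => bisum_p1 p1 p2 bQ (tw_f X i) (tw_f Y i))
                           (fun i => bisum_p1 p1 p2 bQ (tw_g X i) (tw_g Y i))).
exists (@MkTwHom Z Y p2 j2 (fun i => bisum_p2 p1 p2 bQ (tw_f X i) (tw_f Y i))
                           (fun i => bisum_p2 p1 p2 bQ (tw_g X i) (tw_g Y i))).
have [P1 P2 P3 P4 P5] := bP; have [Q1 Q2 Q3 Q4 Q5] := bQ.
by split; apply: twhom_eq.
Qed.

Definition TwAr_add : AdditiveCategory :=
  MkAdditiveCategory tw_comp_addl tw_comp_addr
    tw_has_zero_object tw_has_biproducts.

Definition tw_dual (X : TwArrow) : TwArrow :=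
  MkTwArrow (fun i => adj (tw_g X i)) (fun i => adj (tw_f X i)).

Definition tw_dualm (X Y : TwArrow) (u : TwHom X Y) :
    TwHom (tw_dual Y) (tw_dual X) :=
  @MkTwHom (tw_dual Y) (tw_dual X) (tw_psi u) (tw_phi u)
    (fun i => adj_intertwine (tw_compat_g u i))
    (fun i => adj_intertwine (tw_compat_f u i)).

(* By [adjK], the double dual of [X] has the same components as [X]. *)
Definition tw_omega (X : TwArrow) : TwHom X (tw_dual (tw_dual X)).
Proof.
refine (@MkTwHom X (tw_dual (tw_dual X)) (idm (tw_M X)) (idm (tw_N X)) _ _) => i;
  by rewrite /= adjK dualm_id comp_idl comp_idr.
Defined.

Definition TwAr_herm : HermitianStructure TwAr_add.
Proof.
refine (@MkHermitianStructure TwAr_add tw_dual tw_dualm _ _ _ tw_omega _ _).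
- by move=> *; apply: twhom_eq.
- by move=> *; apply: twhom_eq.
- by move=> *; apply: twhom_eq.
- by move=> *; apply: twhom_eq; rewrite /= comp_idl comp_idr.
- by move=> *; apply: twhom_eq; rewrite /= comp_idl.
Defined.

Definition TwAr : HermitianCategory := MkHermitianCategory TwAr_herm.

Definition F_tw (X : SesqSystem) : TwArrow :=
  MkTwArrow (fun i => adj (sys_form X i)) (fun i => sys_form X i).

Definition F_mor (X : SesqSystem) : TwHom (F_tw X) (tw_dual (F_tw X)).
Proof.
refine (@MkTwHom (F_tw X) (tw_dual (F_tw X)) (idm (sys_ob X)) (idm (sys_ob X))
    _ _) => i; by rewrite /= ?adjK dualm_id comp_idl comp_idr.
Defined.

Definition F_form (X : SesqSystem) : SesqForm TwAr :=
  @MkSesqForm TwAr (F_tw X) (F_mor X).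

Lemma F_hermitian (X : SesqSystem) : hermitian1 (F_form X).
Proof. by apply: twhom_eq; rewrite /= comp_idl. Qed.

Lemma F_unimodular (X : SesqSystem) : unimodular (F_form X).
Proof.
suff iF : is_iso (form_mor (F_form X)) by split; rewrite -?F_hermitian.
have v_f i : dualm (h i) (idm (sys_ob X)) ∘ tw_f (tw_dual (F_tw X)) i =
    tw_f (F_tw X) i ∘ idm (sys_ob X).
  by rewrite /= dualm_id comp_idl comp_idr.
have v_g i : dualm (h i) (idm (sys_ob X)) ∘ tw_g (tw_dual (F_tw X)) i =
    tw_g (F_tw X) i ∘ idm (sys_ob X).
  by rewrite /= adjK dualm_id comp_idl comp_idr.
pose v := @MkTwHom (tw_dual (F_tw X)) (F_tw X) (idm _) (idm _) v_f v_g.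
have vl : (v : @Hom TwAr _ _) ∘ F_mor X = idm (F_tw X : TwAr).
  by apply: twhom_eq; rewrite /= comp_idl.
have vr : (F_mor X : @Hom TwAr _ _) ∘ v = idm (tw_dual (F_tw X) : TwAr).
  by apply: twhom_eq; rewrite /= comp_idl.
by exists (MkIso vl vr).
Qed.

Definition F_ob (X : SesqSystem) : UH1 TwAr :=
  MkUH1_ob (F_unimodular X) (F_hermitian X).

Section FHom.
Variables (X Y : SesqSystem) (u : SysIsometry X Y).

Lemma F_compat_g i :
  dualm (h i) (iso_inv u) ∘ sys_form X i = sys_form Y i ∘ u.
Proof.
rewrite -(sysisomP u i) !comp_assoc -dualm_comp iso_invr dualm_id.
by rewrite comp_idl.
Qed.

Lemma F_compat_f i :
  dualm (h i) (iso_inv u) ∘ adj (sys_form X i) = adj (sys_form Y i) ∘ u.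
Proof.
apply: adj_intertwine.
by rewrite -(sysisomP u i) -comp_assoc iso_invr comp_idr.
Qed.

Lemma Finv_compat_g i : dualm (h i) u ∘ sys_form Y i = sys_form X i ∘ iso_inv u.
Proof. by rewrite -(sysisomP u i) -comp_assoc iso_invr comp_idr. Qed.

Lemma Finv_compat_f i :
  dualm (h i) u ∘ adj (sys_form Y i) = adj (sys_form X i) ∘ iso_inv u.
Proof. by apply: adj_intertwine; apply: F_compat_g. Qed.

Definition F_twhom : TwHom (F_tw X) (F_tw Y) :=
  @MkTwHom (F_tw X) (F_tw Y) u (iso_inv u) F_compat_f F_compat_g.

Definition F_twinv : TwHom (F_tw Y) (F_tw X) :=
  @MkTwHom (F_tw Y) (F_tw X) (iso_inv u) u Finv_compat_f Finv_compat_g.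

Lemma F_invl : (F_twinv : @Hom TwAr _ _) ∘ F_twhom = idm (F_tw X : TwAr).
Proof. by apply: twhom_eq; rewrite /= iso_invl. Qed.

Lemma F_invr : (F_twhom : @Hom TwAr _ _) ∘ F_twinv = idm (F_tw Y : TwAr).
Proof. by apply: twhom_eq; rewrite /= iso_invr. Qed.

Definition F_iso : Iso (F_tw X : TwAr) (F_tw Y : TwAr) := MkIso F_invl F_invr.

Lemma F_isomP :
  form_mor (F_form X) = dualm (hstr TwAr) F_iso ∘ form_mor (F_form Y) ∘ F_iso.
Proof. by apply: twhom_eq; rewrite /= ?comp_idr ?comp_idl iso_invl. Qed.

Definition F_hom : @Hom (UH1 TwAr) (F_ob X) (F_ob Y) :=
  @MkIsometry TwAr (F_form X) (F_form Y) F_iso F_isomP.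

End FHom.

Lemma F_id (X : Sesq) : F_hom (idm X) = idm (F_ob X).
Proof. by apply: isom_eq; apply: twhom_eq. Qed.

Lemma F_comp (X Y Z : Sesq) (v : Hom Y Z) (u : Hom X Y) :
  F_hom (v ∘ u) = F_hom v ∘ F_hom u.
Proof. by apply: isom_eq; apply: twhom_eq. Qed.

Definition F : Functor Sesq (UH1 TwAr) :=
  @MkFunctor Sesq (UH1 TwAr) F_ob F_hom F_id F_comp.

End Systems.

(* Main.v *)
(** A form on a twisted double arrow [(M, N, f, g)] is a pair of maps
    [α, β : M -> N]; it is 1-hermitian iff [α = β], and unimodular iff [α] is
    moreover invertible.  So [α] identifies [N] with [M], and turns the arrow
    into [(M, M, α^* f, α^* g)], where compatibility with duals makes [α^* f]
    the adjoint of [α^* g].  Hence the quasi-inverse of [F] sends the form to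
    [(M, α^* g)], and the counit is [(id, (α^-1)^op)].  An isometry satisfies
    [α = ψ α' φ], so it is determined by [φ]. *)
From mathcomp Require Import ssreflect ssrfun boolp.
Require Import Defs.

Set Implicit Arguments.
Unset Strict Implicit.
Unset Printing Implicit Defensive.

Local Open Scope cat_scope.

Definition iso_sym (C : Category) (A B : C) (u : Iso A B) : Iso B A :=
  MkIso (iso_invr u) (iso_invl u).

Lemma isom_inv_proof (D : HermitianCategory) (X Y : SesqForm D)
    (u : Isometry X Y) :
  form_mor Y = dualm (hstr D) (iso_sym u) ∘ form_mor X ∘ iso_sym u.
Proof.
rewrite (isomP u) /= !comp_assoc -dualm_comp iso_invr dualm_id comp_idl.
by rewrite -comp_assoc iso_invr comp_idr.
Qed.

Definition isometry_inv (D : HermitianCategory) (X Y : SesqForm D)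
    (u : Isometry X Y) : Isometry Y X := MkIsometry (isom_inv_proof u).

Lemma isometry_invl (D : HermitianCategory) (X Y : UH1 D) (u : Hom X Y) :
  (isometry_inv u : Hom Y X) ∘ u = idm X.
Proof. by apply: isom_eq; rewrite /= iso_invl. Qed.

Lemma isometry_invr (D : HermitianCategory) (X Y : UH1 D) (u : Hom X Y) :
  u ∘ (isometry_inv u : Hom Y X) = idm Y.
Proof. by apply: isom_eq; rewrite /= iso_invr. Qed.

(** Both categories of forms are groupoids, so for the natural isomorphisms it suffices to construct
    isometries. *)
Definition UH1_iso (D : HermitianCategory) (X Y : UH1 D) (u : Hom X Y) :
  Iso X Y := MkIso (isometry_invl u) (isometry_invr u).

Section Equivalence.
Variables (C : AdditiveCategory) (I : Type) (h : I -> HermitianStructure C).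

Lemma sysisom_inv_proof (X Y : SesqSystem h) (u : SysIsometry X Y) i :
  dualm (h i) (iso_sym u) ∘ sys_form X i ∘ iso_sym u = sys_form Y i.
Proof.
rewrite -(sysisomP u) /= !comp_assoc -dualm_comp iso_invr dualm_id comp_idl.
by rewrite -comp_assoc iso_invr comp_idr.
Qed.

Definition sysisom_inv (X Y : SesqSystem h) (u : SysIsometry X Y) :
  SysIsometry Y X := MkSysIsometry (sysisom_inv_proof u).

Lemma sysisom_invl (X Y : Sesq h) (u : Hom X Y) :
  (sysisom_inv u : Hom Y X) ∘ u = idm X.
Proof. by apply: sysisom_eq; rewrite /= iso_invl. Qed.

Lemma sysisom_invr (X Y : Sesq h) (u : Hom X Y) :
  u ∘ (sysisom_inv u : Hom Y X) = idm Y.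
Proof. by apply: sysisom_eq; rewrite /= iso_invr. Qed.

Definition Sesq_iso (X Y : Sesq h) (u : Hom X Y) : Iso X Y :=
  MkIso (sysisom_invl u) (sysisom_invr u).

Section TwIso.
Variables (X Y : TwArrow h) (p : Iso (tw_M X) (tw_M Y))
  (q : Iso (tw_N Y) (tw_N X)).

Lemma tw_compat_inv i (f : Hom (tw_M X) (dual (h i) (tw_N X)))
    (f' : Hom (tw_M Y) (dual (h i) (tw_N Y))) :
  dualm (h i) q ∘ f = f' ∘ p ->
  dualm (h i) (iso_inv q) ∘ f' = f ∘ iso_inv p.
Proof.
move=> E; rewrite -[f']comp_idr -(iso_invr p) [f' ∘ _]comp_assoc -E.
by rewrite !comp_assoc -dualm_comp iso_invr dualm_id comp_idl.
Qed.

Hypothesis Ef : forall i, dualm (h i) q ∘ tw_f X i = tw_f Y i ∘ p.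
Hypothesis Eg : forall i, dualm (h i) q ∘ tw_g X i = tw_g Y i ∘ p.

Let v : @Hom (TwAr h) X Y := MkTwHom Ef Eg.
Let w : @Hom (TwAr h) Y X :=
  MkTwHom (fun i => tw_compat_inv (Ef i)) (fun i => tw_compat_inv (Eg i)).

Lemma tw_iso_invl : w ∘ v = idm (X : TwAr h).
Proof. by apply: twhom_eq; rewrite /= ?iso_invl ?iso_invr. Qed.

Lemma tw_iso_invr : v ∘ w = idm (Y : TwAr h).
Proof. by apply: twhom_eq; rewrite /= ?iso_invl ?iso_invr. Qed.

(** A compatible pair is invertible as soon as both components are: the commuting squares invert as
    well. *)
Definition tw_iso : @Iso (TwAr h) X Y := MkIso tw_iso_invl tw_iso_invr.

End TwIso.

Definition phi_iso (X Y : TwAr h) (u : Iso X Y) : Iso (tw_M X) (tw_M Y) :=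
  MkIso (congr1 (@tw_phi _ _ _ _ _) (iso_invl u))
        (congr1 (@tw_phi _ _ _ _ _) (iso_invr u)).

Section Form.
Variable X : UH1 (TwAr h).

Lemma form_iso_exists : is_iso (tw_phi (form_mor X)).
Proof. by have [[u <-] _] := uh_unimodular X; exists (phi_iso u). Qed.

(** This is [α]. Unimodularity only asserts that an inverse exists; the choice made by [cid] is
    harmless since inverses are unique. *)
Definition form_iso : Iso (tw_M (form_ob X)) (tw_N (form_ob X)) :=
  sval (cid form_iso_exists).

Lemma form_isoE : iso_hom form_iso = tw_phi (form_mor X).
Proof. exact: svalP (cid form_iso_exists). Qed.

(** Duality swaps the two components of a morphism and [tw_omega] is a pair of identities, so the
    hermitian condition forces [α = β]. *)
Lemma form_iso_psi : tw_psi (form_mor X) = form_iso.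
Proof.
rewrite form_isoE; have /= -> := congr1 (@tw_psi _ _ _ _ _) (uh_hermitian X).
by rewrite comp_idl.
Qed.

Lemma form_compat_f i :
  dualm (h i) form_iso ∘ tw_f (form_ob X) i = adj (tw_g (form_ob X) i) ∘ form_iso.
Proof. by have := tw_compat_f (form_mor X) i; rewrite form_iso_psi -form_isoE. Qed.

Definition G_sys : SesqSystem h :=
  MkSesqSystem (fun i => dualm (h i) form_iso ∘ tw_g (form_ob X) i).

(** Naturality of [omega] moves [α] out of the adjoint, giving [adj g ∘ α], which the compatibility
    of the form with duals equates with [α^* f]. *)
Lemma adj_G_sys i :
  adj (sys_form G_sys i) = dualm (h i) form_iso ∘ tw_f (form_ob X) i.
Proof.
rewrite form_compat_f /adj /= dualm_comp -!comp_assoc.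
by congr (_ ∘ _); rewrite -omega_nat.
Qed.

Lemma counit_compat_f i :
  dualm (h i) (iso_sym form_iso) ∘ tw_f (F_tw G_sys) i =
  tw_f (form_ob X) i ∘ iso_id (tw_M (form_ob X)).
Proof.
rewrite [tw_f (F_tw _) i]adj_G_sys comp_assoc -dualm_comp iso_invr dualm_id.
by rewrite comp_idl comp_idr.
Qed.

Lemma counit_compat_g i :
  dualm (h i) (iso_sym form_iso) ∘ tw_g (F_tw G_sys) i =
  tw_g (form_ob X) i ∘ iso_id (tw_M (form_ob X)).
Proof.
by rewrite /= comp_assoc -dualm_comp iso_invr dualm_id comp_idl comp_idr.
Qed.

Definition counit_tw : @Iso (TwAr h) (F_tw G_sys) (form_ob X) :=
  tw_iso counit_compat_f counit_compat_g.

Lemma counit_isomP :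
  form_mor (F_form G_sys) =
  dualm (hstr (TwAr h)) counit_tw ∘ form_mor X ∘ counit_tw.
Proof.
apply: twhom_eq; rewrite /= ?form_iso_psi -?form_isoE comp_idr ?comp_idl;
  by rewrite iso_invl.
Qed.

Definition counit : @Hom (UH1 (TwAr h)) (F h G_sys) X :=
  @MkIsometry (TwAr h) (F_form G_sys) X counit_tw counit_isomP.

End Form.

Lemma isom_form_iso (X Y : UH1 (TwAr h)) (u : Hom X Y) :
  tw_psi (iso_hom u) ∘ form_iso Y ∘ tw_phi (iso_hom u) = form_iso X.
Proof. by rewrite !form_isoE (isomP u). Qed.

Lemma isom_eq_phi (X Y : UH1 (TwAr h)) (u v : Hom X Y) :
  tw_phi (iso_hom u) = tw_phi (iso_hom v) -> u = v.
Proof.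
move=> E; apply: isom_eq; apply: twhom_eq => //.
(* Solve [α = ψ α' φ] for [ψ]; all three maps other than [ψ] are invertible. *)
have psiE (w : Hom X Y) : tw_psi (iso_hom w) =
    form_iso X ∘ iso_inv (phi_iso w) ∘ iso_inv (form_iso Y).
  have phiV : tw_phi (iso_hom w) ∘ iso_inv (phi_iso w) = idm _.
    exact: (iso_invr (phi_iso w)).
  rewrite -(isom_form_iso w) -[_ ∘ iso_inv (phi_iso w)]comp_assoc phiV.
  by rewrite comp_idr -comp_assoc iso_invr comp_idr.
by rewrite !psiE (iso_eq (u := phi_iso u) (v := phi_iso v) E).
Qed.

(** Substituting [α = ψ α' φ] in [α^* g] produces [ψ^* g], which equals [g' φ]. *)
Lemma G_isomP (X Y : UH1 (TwAr h)) (u : Hom X Y) i :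
  dualm (h i) (phi_iso u) ∘ sys_form (G_sys Y) i ∘ phi_iso u =
  sys_form (G_sys X) i.
Proof.
rewrite /= -[X in _ = dualm (h i) X ∘ _](isom_form_iso u) !dualm_comp.
by rewrite -!comp_assoc tw_compat_g.
Qed.

Definition G_hom (X Y : UH1 (TwAr h)) (u : Hom X Y) :
  @Hom (Sesq h) (G_sys X) (G_sys Y) :=
  @MkSysIsometry _ _ _ (G_sys X) (G_sys Y) (phi_iso u) (G_isomP u).

Lemma G_id (X : UH1 (TwAr h)) : G_hom (idm X) = idm (G_sys X : Sesq h).
Proof. exact: sysisom_eq. Qed.

Lemma G_comp (X Y Z : UH1 (TwAr h)) (v : Hom Y Z) (u : Hom X Y) :
  G_hom (v ∘ u) = G_hom v ∘ G_hom u.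
Proof. exact: sysisom_eq. Qed.

Definition G : Functor (UH1 (TwAr h)) (Sesq h) :=
  @MkFunctor (UH1 (TwAr h)) (Sesq h) G_sys G_hom G_id G_comp.

(** The form of [F h X] has [α = id], so [G] returns the original forms and the identity of the
    underlying object is an isometry. *)
Lemma GF_isomP (X : Sesq h) i :
  dualm (h i) (iso_id (sys_ob X)) ∘ sys_form X i ∘ iso_id (sys_ob X) =
  sys_form (G (F h X)) i.
Proof.
by rewrite sysisom_id_proof /= form_isoE dualm_id comp_idl.
Qed.

Definition GF_hom (X : Sesq h) : Hom (G (F h X)) X :=
  @MkSysIsometry _ _ _ (G (F h X)) X (iso_id (sys_ob X)) (GF_isomP X).

End Equivalence.

Theorem theorem4p1 (C : AdditiveCategory) (I : Type)
    (h : I -> HermitianStructure C) (hI : inhabited I) :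
  is_equivalence (F h).
Proof.
exists (G h); split; constructor.
- exists (fun X => Sesq_iso (GF_hom X)) => X Y u.
  by apply: sysisom_eq; rewrite /= comp_idl comp_idr.
- exists (fun X => UH1_iso (counit X)) => X Y u.
  (* Only the [φ]-components need comparing, and there the counit is the identity. *)
  by apply: isom_eq_phi; rewrite /= comp_idl comp_idr.
Qed.
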